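(* For $a,b,c,d,e,f,g,h\in\mathbb{C}$ let $T_{8F}(a,b,c,d,e,f,g,h)$ be the $8\times8$ matrix $$ \begin{bmatrix} 1 & a b & e f & a b e f & c d & d h & c g & g h \\ a b & 1 & -a b e f & -e f & d h & c d & -g h & -c g \\ e f & -a b e f & -1 & a b & -c g & g h & c d & -d h \\ a b e f & -e f & a b & -1 & -g h & c g & -d h & c d \\ b e & -a e & b f & -a f & 1 & -c h & d g & -c d g h \\ a e & -b e & -a f & b f & c h & -1 & -c d g h & d g \\ b f & a f & -b e & -a e & -d g & -c d g h & 1 & c h \\ a f & b f & a e & b e & -c d g h & -d g & -c h & -1 \end{bmatrix}. $$ For real $a_r,b_r,c_i\in[-1,1]$ set $a_i=\sqrt{1-a_r^2}$, $b_i=\sqrt{1-b_r^2}$, $c_r=\sqrt{1-c_i^2}$, \begin{align*} A_1&=(c_i - b_i) (b_i + c_i),\qquad A_2=-a_i^4 b_r^2+a_r^4 c_i^2+a_i^2 b_r^2 c_i^2-a_r^2 b_r^2 c_i^2,\\ B_1&=(a_r - b_r) (a_r + b_r),\quad B_2=-a_r^2 b_r^2 + a_r^2 c_i^2 + c_r^2,\quad B_3=a_i^2 b_r^2 + a_r^2 c_i^2 - b_r^2 c_i^2,\quad B_4=-a_i^2 b_r^2 - a_r^2 c_i^2, \end{align*} and \begin{align*} d_r&=\frac{b_i \sqrt{ A_2}}{c_i\sqrt{ B_1B_2}},& d_i&=i\frac{a_i \sqrt{A_1B_3}}{|c_i| \sqrt{B_1B_2}},& e_r&=\frac{ \sqrt{A_2}}{\sqrt{B_1B_2}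 },& e_i&=i\frac{a_r b_i \sqrt{A_1}}{\sqrt{B_1B_2 }},\\ f_r&=-\frac{a_ib_r|c_i|\sqrt{A_1} } { c_i\sqrt{B_1B_4} },& f_i&=i\frac{|c_i|\sqrt{A_2}}{c_i\sqrt{B_1B_4}},& g_r&=\frac{a_r\sqrt{A_1B_3}}{c_r\sqrt{B_1B_4}},& g_i&=i\frac{b_r|c_i|\sqrt{A_2}}{c_r c_i\sqrt{B_1B_4}},\\ h_r&=-\frac{a_i b_r c_r|c_i|}{\sqrt{B_3}\,c_i},& h_i&=\frac{ a_r b_i |c_i|}{\sqrt{B_3}}, \end{align*} with $d'=d_r+id_i$, $e'=e_r+ie_i$, $f'=f_r+if_i$, $g'=g_r+ig_i$, $h'=h_r+ih_i$ (here $i$ is the imaginary unit). Let $\mathcal{S}_F(a_r,b_r,c_i)=T_{8F}(a_r+ia_i,\,b_r+ib_i,\,c_r+ic_i,\,d',e',f',g',h')$ and let $D$ be the set of $(a_r,b_r,c_i)\in[-1,1]^3$ for which $d_r,e_r,f_r,g_r,h_r$ are defined and all lie in $[-1,1]$. Then $T^{(3)}_{8F}:=\mathcal{S}_F(D)$ is a $3$-parameter family of complex Hadamard matrices.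
   Context: $\mathbb{T}=\{z\in\mathbb{C}:|z|=1\}$. A matrix $H\in M_n(\mathbb{T})$ is a complex Hadamard matrix of order $n$ if $HH^\dagger=nI$; the set of these is $\mathbb{H}(n)$. A $k$-parameter family of complex Hadamard matrices is a set $f(D)$ where $D\subseteq\mathbb{R}^k$ and $f:D\to\mathbb{H}(n)$ is continuous, such that $k$ equals the rank of the Jacobian matrix of $f$ (as a map into $\mathbb{C}^{n\times n}\cong\mathbb{R}^{2n^2}$) at some interior point of $D$. $\sqrt{\cdot}$ denotes the principal branch of the complex square root (so $\sqrt{x}=i\sqrt{-x}$ for real $x<0$). *)

(* Defs.v *)
From HB Require Import structures.
From mathcomp Require Import all_boot all_order all_algebra.
From mathcomp Require Import complex.
From mathcomp Require Import mathcomp_extra boolp classical_sets functions reals.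
From mathcomp Require Import topology normedtype derive.

Set Implicit Arguments.
Unset Strict Implicit.
Unset Printing Implicit Defensive.

Import Order.TTheory GRing.Theory Num.Theory.
Import numFieldNormedType.Exports.

Local Open Scope classical_set_scope.
Local Open Scope complex_scope.
Local Open Scope sesquilinear_scope.
Local Open Scope ring_scope.

Definition hadamard (R : realType) (n : nat) : set 'M[R[i]]_n :=
  [set H : 'M[R[i]]_n | (forall i j, `|H i j| = 1) /\ H *m H ^t* = (n%:R)%:M].

(* The identification of the n x n complex matrices with R^(2n^2). *)
Definition realify (R : realType) (n : nat) (M : 'M[R[i]]_n) :
    'rV[R]_(n * n + n * n) :=
  row_mx (mxvec (map_mx (@complex.Re R) M)) (mxvec (map_mx (@complex.Im R) M)).

(* F is the k-parameter family f(D).  Only the values of f on D matter:      *)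
(* [{within D, continuous _}] refers to the subspace topology of D, and the  *)
(* Jacobian is taken at an interior point of D.  Continuity and the Jacobian *)
(* are those of f read in R^(2n^2) through [realify]; 'J is the transpose of *)
(* the usual Jacobian matrix (row-vector convention), with the same rank; it *)
(* has no meaning without differentiability.                                 *)
Definition parameter_family (R : realType) (n k : nat) (D : set 'rV[R]_k)
    (f : 'rV[R]_k -> 'M[R[i]]_n) (F : set 'M[R[i]]_n) : Prop :=
  [/\ F = f @` D,
      forall x, D x -> hadamard (f x),
      {within D, continuous (@realify R n \o f)} &
      exists p, [/\ D^° p, differentiable (@realify R n \o f) p &
                    \rank ('J (@realify R n \o f) p) = k]].

Definition T8F (R : realType) (a b c d e f g h : R[i]) : 'M[R[i]]_8 :=
  \matrix_(i < 8, j < 8) nth 0 (nth [::] [::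
    [:: 1; a * b; e * f; a * b * e * f; c * d; d * h; c * g; g * h];
    [:: a * b; 1; - (a * b * e * f); - (e * f);
        d * h; c * d; - (g * h); - (c * g)];
    [:: e * f; - (a * b * e * f); -1; a * b;
        - (c * g); g * h; c * d; - (d * h)];
    [:: a * b * e * f; - (e * f); a * b; -1;
        - (g * h); c * g; - (d * h); c * d];
    [:: b * e; - (a * e); b * f; - (a * f);
        1; - (c * h); d * g; - (c * d * g * h)];
    [:: a * e; - (b * e); - (a * f); b * f;
        c * h; -1; - (c * d * g * h); d * g];
    [:: b * f; a * f; - (b * e); - (a * e);
        - (d * g); - (c * d * g * h); 1; c * h];
    [:: a * f; b * f; a * e; b * e;
        - (c * d * g * h); - (d * g); - (c * h); -1]] i) j.

(* [sqrtc] is the principal branch of the complex square root. *)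
Definition csqrt (R : realType) (x : R) : R[i] := sqrtc x%:C.

(* a_i, b_i and c_r are [cosqrt] of a_r, b_r and c_i, respectively. *)
Definition cosqrt (R : realType) (x : R) : R := Num.sqrt (1 - x ^+ 2).

Definition A1 (R : realType) (ar br ci : R) : R :=
  let bi := cosqrt br in (ci - bi) * (bi + ci).

Definition A2 (R : realType) (ar br ci : R) : R :=
  let ai := cosqrt ar in
  - (ai ^+ 4 * br ^+ 2) + ar ^+ 4 * ci ^+ 2 + ai ^+ 2 * br ^+ 2 * ci ^+ 2
  - ar ^+ 2 * br ^+ 2 * ci ^+ 2.

Definition B1 (R : realType) (ar br ci : R) : R := (ar - br) * (ar + br).

Definition B2 (R : realType) (ar br ci : R) : R :=
  let cr := cosqrt ci in
  - (ar ^+ 2 * br ^+ 2) + ar ^+ 2 * ci ^+ 2 + cr ^+ 2.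

Definition B3 (R : realType) (ar br ci : R) : R :=
  let ai := cosqrt ar in
  ai ^+ 2 * br ^+ 2 + ar ^+ 2 * ci ^+ 2 - br ^+ 2 * ci ^+ 2.

Definition B4 (R : realType) (ar br ci : R) : R :=
  let ai := cosqrt ar in - (ai ^+ 2 * br ^+ 2) - ar ^+ 2 * ci ^+ 2.

Definition sqrtB12 (R : realType) (ar br ci : R) : R[i] :=
  csqrt (B1 ar br ci * B2 ar br ci).

Definition sqrtB14 (R : realType) (ar br ci : R) : R[i] :=
  csqrt (B1 ar br ci * B4 ar br ci).

Definition sqrtA1B3 (R : realType) (ar br ci : R) : R[i] :=
  csqrt (A1 ar br ci * B3 ar br ci).

Definition dr (R : realType) (ar br ci : R) : R[i] :=
  let bi := cosqrt br in
  bi%:C * csqrt (A2 ar br ci) / (ci%:C * sqrtB12 ar br ci).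

Definition di (R : realType) (ar br ci : R) : R[i] :=
  let ai := cosqrt ar in
  'i%C * (ai%:C * sqrtA1B3 ar br ci / (`|ci|%:C * sqrtB12 ar br ci)).

Definition er (R : realType) (ar br ci : R) : R[i] :=
  csqrt (A2 ar br ci) / sqrtB12 ar br ci.

Definition ei (R : realType) (ar br ci : R) : R[i] :=
  let bi := cosqrt br in
  'i%C * (ar%:C * bi%:C * csqrt (A1 ar br ci) / sqrtB12 ar br ci).

Definition fr (R : realType) (ar br ci : R) : R[i] :=
  let ai := cosqrt ar in
  - (ai%:C * br%:C * `|ci|%:C * csqrt (A1 ar br ci)
     / (ci%:C * sqrtB14 ar br ci)).

Definition fi (R : realType) (ar br ci : R) : R[i] :=
  'i%C * (`|ci|%:C * csqrt (A2 ar br ci) / (ci%:C * sqrtB14 ar br ci)).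

Definition gr (R : realType) (ar br ci : R) : R[i] :=
  let cr := cosqrt ci in
  ar%:C * sqrtA1B3 ar br ci / (cr%:C * sqrtB14 ar br ci).

Definition gi (R : realType) (ar br ci : R) : R[i] :=
  let cr := cosqrt ci in
  'i%C * (br%:C * `|ci|%:C * csqrt (A2 ar br ci)
        / (cr%:C * ci%:C * sqrtB14 ar br ci)).

Definition hr (R : realType) (ar br ci : R) : R[i] :=
  let ai := cosqrt ar in let cr := cosqrt ci in
  - (ai%:C * br%:C * cr%:C * `|ci|%:C / (csqrt (B3 ar br ci) * ci%:C)).

Definition hi (R : realType) (ar br ci : R) : R[i] :=
  let bi := cosqrt br in
  ar%:C * bi%:C * `|ci|%:C / csqrt (B3 ar br ci).

Definition SF (R : realType) (ar br ci : R) : 'M[R[i]]_8 :=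
  T8F (ar +i* cosqrt ar) (br +i* cosqrt br) (cosqrt ci +i* ci)
    (dr ar br ci + 'i%C * di ar br ci) (er ar br ci + 'i%C * ei ar br ci)
    (fr ar br ci + 'i%C * fi ar br ci) (gr ar br ci + 'i%C * gi ar br ci)
    (hr ar br ci + 'i%C * hi ar br ci).

(* Division is total in the library, so definedness of d_r, ..., h_r is the  *)
(* nonvanishing of their five denominators.                                  *)
Definition SF_defined (R : realType) (ar br ci : R) : Prop :=
  [/\ ci%:C * sqrtB12 ar br ci != 0,
      sqrtB12 ar br ci != 0,
      ci%:C * sqrtB14 ar br ci != 0,
      (cosqrt ci)%:C * sqrtB14 ar br ci != 0 &
      csqrt (B3 ar br ci) * ci%:C != 0].

Definition in_Icc_m1_1 (R : realType) (z : R[i]) : Prop :=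
  exists2 x : R, -1 <= x <= 1 & z = x%:C.

(* Points of R^3 are row vectors (a_r, b_r, c_i). *)
Definition SF_dom (R : realType) : set 'rV[R]_3 :=
  [set p | let ar := p 0 0 in let br := p 0 1 in let ci := p 0 2%:R in
    [/\ [/\ -1 <= ar <= 1, -1 <= br <= 1 & -1 <= ci <= 1],
        SF_defined ar br ci &
        [/\ in_Icc_m1_1 (dr ar br ci), in_Icc_m1_1 (er ar br ci),
            in_Icc_m1_1 (fr ar br ci), in_Icc_m1_1 (gr ar br ci) &
            in_Icc_m1_1 (hr ar br ci)]]].

Definition SF_map (R : realType) (p : 'rV[R]_3) : 'M[R[i]]_8 :=
  SF (p 0 0) (p 0 1) (p 0 2%:R).

Definition T8F3 (R : realType) : set 'M[R[i]]_8 := @SF_map R @` @SF_dom R.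

(* Main.v *)
(* Every entry of T8F is a monomial in a, ..., h up to sign, so on the torus
   H H^dagger = 8 I amounts to 28 Laurent-polynomial identities.  Those which
   do not cancel identically factor, and reduce to six real equations:
     Im(ab) Re(ef) = Im(h/c) Re(d/g),  Im(b/a) Re(e/f) = - Im(ch) Re(dg),
     c_i d_r = b_i e_r,  a_i e_i = d_i h_i,  c_r g_i = b_r f_i,
     a_r f_r = g_r h_r.
   The explicit formulas satisfy them, and d_r^2 + d_i^2 = 1 (likewise for e,
   f, g, h) holds as a complex identity; hence d_i is real as soon as d_r lies
   in [-1,1].  Branches of the square roots only matter through
   sqrt(A1 B3) = sqrt A1 sqrt B3, which is safe because B3 >= 0 on the cube.

   At (1/2, 0, 1/2) the signs A1 < 0 < A2, B1 B2 > 0 > B1 B4, B3 > 0 are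
   strict and force membership in D, so this point is interior.  No
   derivative has to be computed for the rank: if a direction v kills the
   derivatives of the entries ab, ae and be, then by the Leibniz rule it
   kills those of a and b; the entries cd, ch and dh give c in the same way.
   As a, b, c determine the coordinates, v = 0. *)
Require Import Defs.
From mathcomp Require Import all_boot all_order all_algebra.
From mathcomp Require Import ring lra.
From mathcomp Require Import complex.
From mathcomp Require Import boolp classical_sets functions reals.
From mathcomp Require Import topology normedtype derive realfun.

Set Implicit Arguments.
Unset Strict Implicit.
Unset Printing Implicit Defensive.

Import Order.TTheory GRing.Theory Num.Theory.
Import numFieldNormedType.Exports.

Local Open Scope classical_set_scope.
Local Open Scope complex_scope.
Local Open Scope ring_scope.

(** * Orthogonality of the rows *)

(** The table of [T8F] over an arbitrary field. On the torus conjugation is inversion, so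
    orthogonality of two rows becomes a rational identity within reach of [field]. *)
Definition T8F_rows (F : fieldType) (a b c d e f g h : F) : seq (seq F) := [::
    [:: 1; a * b; e * f; a * b * e * f; c * d; d * h; c * g; g * h];
    [:: a * b; 1; - (a * b * e * f); - (e * f);
        d * h; c * d; - (g * h); - (c * g)];
    [:: e * f; - (a * b * e * f); -1; a * b;
        - (c * g); g * h; c * d; - (d * h)];
    [:: a * b * e * f; - (e * f); a * b; -1;
        - (g * h); c * g; - (d * h); c * d];
    [:: b * e; - (a * e); b * f; - (a * f);
        1; - (c * h); d * g; - (c * d * g * h)];
    [:: a * e; - (b * e); - (a * f); b * f;
        c * h; -1; - (c * d * g * h); d * g];
    [:: b * f; a * f; - (b * e); - (a * e);
        - (d * g); - (c * d * g * h); 1; c * h];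
    [:: a * f; b * f; a * e; b * e;
        - (c * d * g * h); - (d * g); - (c * h); -1]].

(** For each of the 28 pairs of rows the sum of quotients either vanishes identically or is, up to
    sign, the left side of one of the six relations; the script finds out which by trial. *)
Lemma T8F_rows_orthogonal (F : fieldType) (a b c d e f g h : F) (i j : nat) :
  a != 0 -> b != 0 -> c != 0 -> d != 0 ->
  e != 0 -> f != 0 -> g != 0 -> h != 0 ->
  (a^-1 * b^-1 - a * b) * (e * f + e^-1 * f^-1)
    + (c^-1 * h - c * h^-1) * (d * g^-1 + d^-1 * g) = 0 ->
  (c - c^-1) * (d + d^-1) - (b - b^-1) * (e + e^-1) = 0 ->
  (a - a^-1) * (e - e^-1) - (d - d^-1) * (h - h^-1) = 0 ->
  (c + c^-1) * (g - g^-1) - (b + b^-1) * (f - f^-1) = 0 ->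
  (a + a^-1) * (f + f^-1) - (g + g^-1) * (h + h^-1) = 0 ->
  (a^-1 * b - a * b^-1) * (e * f^-1 + e^-1 * f)
    + (c * h - c^-1 * h^-1) * (d^-1 * g^-1 + d * g) = 0 ->
  (i < j)%N -> (j < 8)%N ->
  let T := T8F_rows a b c d e f g h in
  \sum_(k < 8) nth 0 (nth [::] T i) k / nth 0 (nth [::] T j) k = 0.
Proof.
move=> a0 b0 c0 d0 e0 f0 g0 h0 k1 k2 k3 k4 k5 k6 ij j8 /=.
have nz := (oppr_eq0, oner_eq0, mulf_eq0, negbTE a0, negbTE b0, negbTE c0,
  negbTE d0, negbTE e0, negbTE f0, negbTE g0, negbTE h0).
have lin (k x : F) : k = 0 -> x = k \/ x = - k -> x = 0.
  by move=> -> [] ->; rewrite ?oppr0.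
rewrite !big_ord_recl big_ord0 /=.
move: i j ij j8 => [|[|[|[|[|[|[|[|i]]]]]]]] [|[|[|[|[|[|[|[|j]]]]]]]] //= _ _;
  first [ by field; rewrite !nz
  | by apply: (lin _ _ k1); first [left; field | right; field]; rewrite !nz
  | by apply: (lin _ _ k2); first [left; field | right; field]; rewrite !nz
  | by apply: (lin _ _ k3); first [left; field | right; field]; rewrite !nz
  | by apply: (lin _ _ k4); first [left; field | right; field]; rewrite !nz
  | by apply: (lin _ _ k5); first [left; field | right; field]; rewrite !nz
  | by apply: (lin _ _ k6); first [left; field | right; field]; rewrite !nz ].
Qed.

(* With [A1], ..., [B4] written as polynomials in the squares, [ci'] standing
   for [|ci|], and [t] for the imaginary unit. *)
Section Parametrization.
Variables (F : fieldType) (t ar ai br bi cr ci ci' al1 al2 s12 s14 b3 : F).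
Hypotheses (t2 : t ^+ 2 = -1) (ai2 : ai ^+ 2 = 1 - ar ^+ 2)
  (bi2 : bi ^+ 2 = 1 - br ^+ 2) (cr2 : cr ^+ 2 = 1 - ci ^+ 2)
  (ci'2 : ci' ^+ 2 = ci ^+ 2).
Let X := ar ^+ 2.
Let Y := br ^+ 2.
Let Z := ci ^+ 2.
Let PA1 := Z - (1 - Y).
Let PA2 := - (1 - X) ^+ 2 * Y + X ^+ 2 * Z + (1 - X) * Y * Z - X * Y * Z.
Let PB1 := X - Y.
Let PB2 := - X * Y + X * Z + (1 - Z).
Let PB3 := (1 - X) * Y + X * Z - Y * Z.
Let PB4 := - ((1 - X) * Y) - X * Z.
Hypotheses (al12 : al1 ^+ 2 = PA1) (al22 : al2 ^+ 2 = PA2)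
  (s122 : s12 ^+ 2 = PB1 * PB2) (s142 : s14 ^+ 2 = PB1 * PB4)
  (b32 : b3 ^+ 2 = PB3).
Hypotheses (ci0 : ci != 0) (cr0 : cr != 0) (s120 : s12 != 0) (s140 : s14 != 0)
  (b30 : b3 != 0).

Let dr := bi * al2 / (ci * s12).
Let di := t * (ai * (al1 * b3) / (ci' * s12)).
Let er := al2 / s12.
Let ei := t * (ar * bi * al1 / s12).
Let fr := - (ai * br * ci' * al1 / (ci * s14)).
Let fi := t * (ci' * al2 / (ci * s14)).
Let gr := ar * (al1 * b3) / (cr * s14).
Let gi := t * (br * ci' * al2 / (cr * ci * s14)).
Let hr := - (ai * br * cr * ci' / (b3 * ci)).
Let hi := ar * bi * ci' / b3.

Let sqrE := (exprMn, exprVn, sqrrN, t2, ai2, bi2, cr2, ci'2, al12, al22,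
  s122, s142, b32).

Let ci'0 : ci' != 0.
Proof. by rewrite -sqrf_eq0 ci'2 sqrf_eq0. Qed.

Let nz := (mulf_eq0, sqrf_eq0, negbTE ci'0, negbTE ci0, negbTE cr0, negbTE s120,
  negbTE s140, negbTE b30).

(** Clears denominators so that only even powers of the roots remain; [sqrE] then turns these into
    polynomials in [ar], [br], [ci], and [ring] concludes. *)
Let quotient_eq1 (w u v : F) : w = u / v -> v != 0 -> u - v = 0 -> w = 1.
Proof. move=> -> v0 /subr0_eq->; exact: divff. Qed.

Lemma d_unimodular : dr ^+ 2 + di ^+ 2 = 1.
Proof.
apply: (@quotient_eq1 _ (bi ^+ 2 * al2 ^+ 2 * ci' ^+ 2
  + t ^+ 2 * ai ^+ 2 * al1 ^+ 2 * b3 ^+ 2 * ci ^+ 2)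
  (ci ^+ 2 * ci' ^+ 2 * s12 ^+ 2)).
- by rewrite /dr /di; field; rewrite !nz.
- by rewrite !nz.
- rewrite !sqrE /PA1 /PA2 /PB1 /PB2 /PB3 /Z /X /Y; ring.
Qed.

Lemma e_unimodular : er ^+ 2 + ei ^+ 2 = 1.
Proof.
apply: (@quotient_eq1 _ (al2 ^+ 2 + t ^+ 2 * ar ^+ 2 * bi ^+ 2 * al1 ^+ 2)
  (s12 ^+ 2)).
- by rewrite /er /ei; field; rewrite !nz.
- by rewrite !nz.
- rewrite !sqrE /PA1 /PA2 /PB1 /PB2 /Z /X /Y; ring.
Qed.

Lemma f_unimodular : fr ^+ 2 + fi ^+ 2 = 1.
Proof.
apply: (@quotient_eq1 _ (ci' ^+ 2 * (ai ^+ 2 * br ^+ 2 * al1 ^+ 2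
  + t ^+ 2 * al2 ^+ 2)) (ci ^+ 2 * s14 ^+ 2)).
- by rewrite /fr /fi; field; rewrite !nz.
- by rewrite !nz.
- rewrite !sqrE /PA1 /PA2 /PB1 /PB4 /Z /X /Y; ring.
Qed.

Lemma g_unimodular : gr ^+ 2 + gi ^+ 2 = 1.
Proof.
apply: (@quotient_eq1 _ (ar ^+ 2 * al1 ^+ 2 * b3 ^+ 2 * ci ^+ 2
  + t ^+ 2 * br ^+ 2 * ci' ^+ 2 * al2 ^+ 2) (cr ^+ 2 * ci ^+ 2 * s14 ^+ 2)).
- by rewrite /gr /gi; field; rewrite !nz.
- by rewrite !nz.
- rewrite !sqrE /PA1 /PA2 /PB1 /PB3 /PB4 /Z /X /Y; ring.
Qed.

Lemma h_unimodular : hr ^+ 2 + hi ^+ 2 = 1.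
Proof.
apply: (@quotient_eq1 _ (ci' ^+ 2 * (ai ^+ 2 * br ^+ 2 * cr ^+ 2
  + ar ^+ 2 * bi ^+ 2 * ci ^+ 2)) (b3 ^+ 2 * ci ^+ 2)).
- by rewrite /hr /hi; field; rewrite !nz.
- by rewrite !nz.
- rewrite !sqrE /PB3 /Z /X /Y; ring.
Qed.

(** [t ^+ 2 = -1] makes [(x - t * y) * (x + t * y)] equal to [x ^+ 2 + y ^+ 2]. Inverses thus become
    formal conjugates, whether or not [x] and [y] are real. *)
Let unit_inv (x y : F) : x ^+ 2 + y ^+ 2 = 1 -> (x + t * y)^-1 = x - t * y.
Proof.
move=> xy1; have xy : (x - t * y) * (x + t * y) = 1.
  have -> : (x - t * y) * (x + t * y) = x ^+ 2 - t ^+ 2 * y ^+ 2 by ring.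
  by rewrite t2 mulN1r opprK.
have xt0 : x + t * y != 0.
  by apply: contra_eq_neq xy => ->; rewrite mulr0 eq_sym oner_eq0.
by apply: (mulIf xt0); rewrite mulVf.
Qed.

Let a := ar + t * ai. Let b := br + t * bi. Let c := cr + t * ci.
Let d := dr + t * di. Let e := er + t * ei. Let f := fr + t * fi.
Let g := gr + t * gi. Let h := hr + t * hi.

(** For real coordinates, this and the next identities give the real parts of [ef], [e/f], [d/g] and
    [dg]. All share the factor [al1 * al2 / (ci * s12 * s14)], which therefore never has to be
    squared. *)
Let ef_re : er * fr - ei * fi
  = ci' * al1 * al2 / (ci * s12 * s14) * (ar * bi - ai * br).
Proof.
(* [field] does not know [t2], so the square of [t] is isolated before it is replaced. *)
have -> : ei * fi = t ^+ 2 * (ar * bi * al1 * ci' * al2 / (ci * s12 * s14)).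
  by rewrite /ei /fi; field; rewrite !nz.
by rewrite t2 /er /fr; field; rewrite !nz.
Qed.

Let ef_re' : er * fr + ei * fi
  = - (ci' * al1 * al2 / (ci * s12 * s14) * (ar * bi + ai * br)).
Proof.
have -> : ei * fi = t ^+ 2 * (ar * bi * al1 * ci' * al2 / (ci * s12 * s14)).
  by rewrite /ei /fi; field; rewrite !nz.
by rewrite t2 /er /fr; field; rewrite !nz.
Qed.

Let digi : di * gi
  = t ^+ 2 * (ai * br * al1 * b3 * al2 / (cr * ci * s12 * s14)).
Proof. by rewrite /di /gi; field; rewrite !nz. Qed.

Let dg_re : dr * gr + di * gi
  = al1 * al2 * b3 / (cr * ci * s12 * s14) * (ar * bi - ai * br).
Proof. by rewrite digi t2 /dr /gr; field; rewrite !nz. Qed.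

Let dg_re' : dr * gr - di * gi
  = al1 * al2 * b3 / (cr * ci * s12 * s14) * (ar * bi + ai * br).
Proof. by rewrite digi t2 /dr /gr; field; rewrite !nz. Qed.

Let aV : a^-1 = ar - t * ai.
Proof. by apply: unit_inv; rewrite ai2 subrKC. Qed.
Let bV : b^-1 = br - t * bi.
Proof. by apply: unit_inv; rewrite bi2 subrKC. Qed.
Let cV : c^-1 = cr - t * ci.
Proof. by apply: unit_inv; rewrite cr2 subrK. Qed.
Let dV : d^-1 = dr - t * di. Proof. exact: unit_inv d_unimodular. Qed.
Let eV : e^-1 = er - t * ei. Proof. exact: unit_inv e_unimodular. Qed.
Let fV : f^-1 = fr - t * fi. Proof. exact: unit_inv f_unimodular. Qed.
Let gV : g^-1 = gr - t * gi. Proof. exact: unit_inv g_unimodular. Qed.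
Let hV : h^-1 = hr - t * hi. Proof. exact: unit_inv h_unimodular. Qed.

(** [cr * hi - ci * hr] is [cr * ci' / b3] times [ar * bi + ai * br], and by [ef_re] and [dg_re] the
    real part of [ef] is the same multiple of that of [d/g]; the two products agree. *)
Lemma T8F_condition1 :
  (a^-1 * b^-1 - a * b) * (e * f + e^-1 * f^-1)
    + (c^-1 * h - c * h^-1) * (d * g^-1 + d^-1 * g) = 0.
Proof.
rewrite aV bV cV dV eV fV gV hV.
transitivity (4 * t * ((cr * hi - ci * hr) * (dr * gr - t ^+ 2 * (di * gi))
  - (ar * bi + ai * br) * (er * fr + t ^+ 2 * (ei * fi)))).
  by rewrite /a /b /c /d /e /f /g /h; ring.
rewrite t2 !mulN1r opprK ef_re dg_re /hi /hr.
by field; rewrite !nz.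
Qed.

Lemma T8F_condition2 :
  (c - c^-1) * (d + d^-1) - (b - b^-1) * (e + e^-1) = 0.
Proof.
rewrite bV cV dV eV.
transitivity (4 * t * (ci * dr - bi * er)).
  by rewrite /b /c /d /e; ring.
by rewrite /dr /er; field; rewrite !nz.
Qed.

Lemma T8F_condition3 :
  (a - a^-1) * (e - e^-1) - (d - d^-1) * (h - h^-1) = 0.
Proof.
rewrite aV dV eV hV.
transitivity (4 * t ^+ 2 * (ai * ei - di * hi)).
  by rewrite /a /d /e /h; ring.
by rewrite /ei /di /hi; field; rewrite !nz.
Qed.

Lemma T8F_condition4 :
  (c + c^-1) * (g - g^-1) - (b + b^-1) * (f - f^-1) = 0.
Proof.
rewrite bV cV fV gV.
transitivity (4 * t * (cr * gi - br * fi)).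
  by rewrite /b /c /f /g; ring.
by rewrite /gi /fi; field; rewrite !nz.
Qed.

Lemma T8F_condition5 :
  (a + a^-1) * (f + f^-1) - (g + g^-1) * (h + h^-1) = 0.
Proof.
rewrite aV fV gV hV.
transitivity (4 * (ar * fr - gr * hr)).
  by rewrite /a /f /g /h; ring.
by rewrite /fr /gr /hr; field; rewrite !nz.
Qed.

(** Here [cr * hi + ci * hr] is [cr * ci' / b3] times [ar * bi - ai * br], while [ef_re'] is the
    opposite multiple of [dg_re'], so the two products cancel. *)
Lemma T8F_condition6 :
  (a^-1 * b - a * b^-1) * (e * f^-1 + e^-1 * f)
    + (c * h - c^-1 * h^-1) * (d^-1 * g^-1 + d * g) = 0.
Proof.
rewrite aV bV cV dV eV fV gV hV.
transitivity (4 * t * ((ar * bi - ai * br) * (er * fr - t ^+ 2 * (ei * fi))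
  + (cr * hi + ci * hr) * (dr * gr + t ^+ 2 * (di * gi)))).
  by rewrite /a /b /c /d /e /f /g /h; ring.
rewrite t2 !mulN1r opprK ef_re' dg_re' /hi /hr.
by field; rewrite !nz.
Qed.

End Parametrization.

(** * Unimodular parameters and the Hadamard property *)

Lemma T8F_hadamard (R : realType) (a b c d e f g h : R[i]) :
  `|a| = 1 -> `|b| = 1 -> `|c| = 1 -> `|d| = 1 ->
  `|e| = 1 -> `|f| = 1 -> `|g| = 1 -> `|h| = 1 ->
  (a^-1 * b^-1 - a * b) * (e * f + e^-1 * f^-1)
    + (c^-1 * h - c * h^-1) * (d * g^-1 + d^-1 * g) = 0 ->
  (c - c^-1) * (d + d^-1) - (b - b^-1) * (e + e^-1) = 0 ->
  (a - a^-1) * (e - e^-1) - (d - d^-1) * (h - h^-1) = 0 ->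
  (c + c^-1) * (g - g^-1) - (b + b^-1) * (f - f^-1) = 0 ->
  (a + a^-1) * (f + f^-1) - (g + g^-1) * (h + h^-1) = 0 ->
  (a^-1 * b - a * b^-1) * (e * f^-1 + e^-1 * f)
    + (c * h - c^-1 * h^-1) * (d^-1 * g^-1 + d * g) = 0 ->
  hadamard (T8F a b c d e f g h).
Proof.
move=> a1 b1 c1 d1 e1 f1 g1 h1 k1 k2 k3 k4 k5 k6.
have neq0 (z : R[i]) : `|z| = 1 -> z != 0.
  by move=> z1; rewrite -normr_eq0 z1 oner_eq0.
set M := T8F _ _ _ _ _ _ _ _.
have M1 i j : `|M i j| = 1.
  rewrite mxE; case: i j => [[|[|[|[|[|[|[|[|i]]]]]]]] //= _]
    [[|[|[|[|[|[|[|[|j]]]]]]]] //= _];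
  by rewrite ?normrN ?normrM ?a1 ?b1 ?c1 ?d1 ?e1 ?f1 ?g1 ?h1 ?normr1 ?mulr1.
have MV i j : (M i j)^* = (M i j)^-1.
  by rewrite invC_norm M1 expr1n invr1 mul1r.
have orth (i j : 'I_8) : (i < j)%N -> \sum_k M i k * (M j k)^* = 0.
  move=> ij.
  rewrite -[RHS](@T8F_rows_orthogonal _ a b c d e f g h i j) ?neq0//.
  by apply: eq_bigr => k _; rewrite MV !mxE.
(* Only [M1], [MV] and [orth] matter from here on; [M] is made opaque so that [mxE] does not expand
   the table. *)
clearbody M; split=> //; apply/matrixP => i j; rewrite !mxE.
under eq_bigr do rewrite !mxE.
have [ij|ji|/val_inj <-] := ltngtP i j.
- by rewrite orth// -(inj_eq val_inj) /= (ltn_eqF ij).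
(* Below the diagonal the inner product is the conjugate of one above it. *)
- rewrite -(inj_eq val_inj) /= (gtn_eqF ji) mulr0n.
  apply: etrans (etrans (congr1 Num.conj (orth _ _ ji)) (conjC0 _)).
  rewrite rmorph_sum.
  by apply: eq_bigr => k _; rewrite rmorphM /= conjCK mulrC.
- rewrite eqxx mulr1n (eq_bigr (fun=> 1)) ?sumr_const ?card_ord// => k _.
  by rewrite -normCK M1 expr1n.
Qed.

(** [y] is a priori complex, but its square [1 - x ^+ 2] is a nonnegative real, so [y] is plus or
    minus a real root. This is where the range [[-1, 1]] forces the parameter onto the unit
    circle. *)
Lemma normc_unit_circle (R : realType) (x : R) (y : R[i]) :
  -1 <= x <= 1 -> x%:C ^+ 2 + y ^+ 2 = 1 -> `|x%:C + 'i%C * y| = 1.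
Proof.
move=> x11 xy1.
have x21 : 0 <= 1 - x ^+ 2 by nra.
have yE : y ^+ 2 = (Num.sqrt (1 - x ^+ 2))%:C ^+ 2.
  rewrite -rmorphXn /= sqr_sqrtr// rmorphB rmorph1 rmorphXn /=.
  by rewrite -xy1 addrAC subrr add0r.
have norm1 (z : R) : z ^+ 2 = 1 - x ^+ 2 -> `|x%:C + 'i%C * z%:C| = 1.
  move=> z2; have -> : x%:C + 'i%C * z%:C = x +i* z by rewrite [RHS]complexE.
  by rewrite normc_def /= z2 subrKC sqrtr1.
have s2 : Num.sqrt (1 - x ^+ 2) ^+ 2 = 1 - x ^+ 2 by rewrite sqr_sqrtr.
move/eqP: yE; rewrite eqf_sqr => /orP[] /eqP ->; first exact: norm1.
by rewrite -rmorphN; apply: norm1; rewrite sqrrN.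
Qed.

(** * Hadamard matrices on the domain *)

Lemma cosqrt_sqr (R : realType) (x : R) :
  -1 <= x <= 1 -> cosqrt x ^+ 2 = 1 - x ^+ 2.
Proof. by move=> x11; rewrite sqr_sqrtr//; nra. Qed.

Lemma csqrt_sqr (R : realType) (x : R) : csqrt x ^+ 2 = x%:C.
Proof. exact: sqr_sqrtc. Qed.

(** [Num.sqrt] is zero on negative numbers, so at most one component is nonzero. In this form
    [csqrt] is visibly continuous on the real line. *)
Lemma csqrtE (R : realType) (x : R) :
  csqrt x = Num.sqrt x +i* Num.sqrt (- x).
Proof.
rewrite /csqrt /sqrtc /= eqxx mul1r expr0n /= addr0 sqrtr_sqr.
have half (y : R) : (y + y) / 2 = y by field.
have [x0|x0] := leP 0 x.
  rewrite ger0_norm// half subrr mul0r sqrtr0.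
  by rewrite [in RHS](@ler0_sqrtr _ (- x)) ?oppr_le0.
by rewrite ltr0_norm// addNr mul0r sqrtr0 half (@ler0_sqrtr _ x)// ltW.
Qed.

(** The sign condition matters: for two negative factors the two sides would differ by a sign. *)
Lemma csqrtM (R : realType) (x y : R) :
  0 <= y -> csqrt (x * y) = csqrt x * csqrt y.
Proof.
move=> y0; rewrite !csqrtE -mulNr (mulrC x) (mulrC (- x)) !sqrtrM//.
rewrite (@ler0_sqrtr _ (- y)) ?oppr_le0//.
by rewrite [RHS]/GRing.mul /= !mulr0 subr0 add0r !(mulrC (Num.sqrt y)).
Qed.

Lemma normc_Complex_cosqrt (R : realType) (x : R) : -1 <= x <= 1 ->
  `|x +i* cosqrt x| = 1 /\ `|cosqrt x +i* x| = 1.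
Proof.
move=> x11; rewrite !normc_def /= cosqrt_sqr//.
by rewrite subrKC subrK sqrtr1.
Qed.

Section SF_on_cube.
Variables (R : realType) (ar br ci : R).
Hypotheses (ar11 : -1 <= ar <= 1) (br11 : -1 <= br <= 1) (ci11 : -1 <= ci <= 1).

(** On the cube [B3] is a sum of two squares, namely those of the numerators of [hr] and [hi] once
    [|ci| / ci] is discarded. This allows [sqrtA1B3] to be split into two roots. *)
Lemma B3_ge0 : 0 <= B3 ar br ci.
Proof.
have -> : B3 ar br ci = cosqrt ar ^+ 2 * br ^+ 2 * cosqrt ci ^+ 2
    + ar ^+ 2 * cosqrt br ^+ 2 * ci ^+ 2.
  rewrite /B3 !cosqrt_sqr//; ring.
by rewrite -!exprMn addr_ge0 ?sqr_ge0.
Qed.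

Hypothesis defd : SF_defined ar br ci.

Let t2 : ('i%C : R[i]) ^+ 2 = -1. Proof. exact: sqr_i. Qed.

Let cosqrtC_sqr (x : R) :
  -1 <= x <= 1 -> (cosqrt x)%:C ^+ 2 = 1 - x%:C ^+ 2 :> R[i].
Proof.
by move=> x11; rewrite -rmorphXn /= cosqrt_sqr// rmorphB rmorph1 rmorphXn.
Qed.

Let ai2 := cosqrtC_sqr ar11.
Let bi2 := cosqrtC_sqr br11.
Let cr2 := cosqrtC_sqr ci11.
Let ci'2 : `|ci|%:C ^+ 2 = ci%:C ^+ 2 :> R[i].
Proof. by rewrite -!rmorphXn /= real_normK// num_real. Qed.

Let al12 : csqrt (A1 ar br ci) ^+ 2 = ci%:C ^+ 2 - (1 - br%:C ^+ 2).
Proof.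
by rewrite csqrt_sqr -bi2 -!rmorphXn -rmorphB; congr (_%:C); rewrite /A1; ring.
Qed.

Let toC := (rmorphD, rmorphB, rmorphN, rmorphM, rmorphXn, rmorph1).

Let al22 : csqrt (A2 ar br ci) ^+ 2 =
  - (1 - ar%:C ^+ 2) ^+ 2 * br%:C ^+ 2 + (ar%:C ^+ 2) ^+ 2 * ci%:C ^+ 2
  + (1 - ar%:C ^+ 2) * br%:C ^+ 2 * ci%:C ^+ 2
  - ar%:C ^+ 2 * br%:C ^+ 2 * ci%:C ^+ 2.
Proof. by rewrite csqrt_sqr -ai2 /A2 /= !toC; ring. Qed.

Let s122 : sqrtB12 ar br ci ^+ 2 = (ar%:C ^+ 2 - br%:C ^+ 2) *
  (- ar%:C ^+ 2 * br%:C ^+ 2 + ar%:C ^+ 2 * ci%:C ^+ 2 + (1 - ci%:C ^+ 2)).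
Proof. by rewrite csqrt_sqr -cr2 /B1 /B2 /= !toC; ring. Qed.

Let s142 : sqrtB14 ar br ci ^+ 2 = (ar%:C ^+ 2 - br%:C ^+ 2) *
  (- ((1 - ar%:C ^+ 2) * br%:C ^+ 2) - ar%:C ^+ 2 * ci%:C ^+ 2).
Proof. by rewrite csqrt_sqr -ai2 /B1 /B4 /= !toC; ring. Qed.

Let b32 : csqrt (B3 ar br ci) ^+ 2 = (1 - ar%:C ^+ 2) * br%:C ^+ 2
  + ar%:C ^+ 2 * ci%:C ^+ 2 - br%:C ^+ 2 * ci%:C ^+ 2.
Proof. by rewrite csqrt_sqr -ai2 /B3 /= !toC; ring. Qed.

Let A1B3E : sqrtA1B3 ar br ci = csqrt (A1 ar br ci) * csqrt (B3 ar br ci).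
Proof. exact/csqrtM/B3_ge0. Qed.

Let ci0 : ci%:C != 0 :> R[i].
Proof. by case: defd; rewrite mulf_eq0 negb_or => /andP[]. Qed.
Let cr0 : (cosqrt ci)%:C != 0 :> R[i].
Proof. by case: defd => _ _ _; rewrite mulf_eq0 negb_or => /andP[]. Qed.
Let s120 : sqrtB12 ar br ci != 0.
Proof. by case: defd. Qed.
Let s140 : sqrtB14 ar br ci != 0.
Proof. by case: defd => _ _; rewrite mulf_eq0 negb_or => /andP[]. Qed.
Let b30 : csqrt (B3 ar br ci) != 0.
Proof. by case: defd => _ _ _ _; rewrite mulf_eq0 negb_or => /andP[]. Qed.

Lemma SF_unimodular :
  [/\ dr ar br ci ^+ 2 + di ar br ci ^+ 2 = 1,
      er ar br ci ^+ 2 + ei ar br ci ^+ 2 = 1,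
      fr ar br ci ^+ 2 + fi ar br ci ^+ 2 = 1,
      gr ar br ci ^+ 2 + gi ar br ci ^+ 2 = 1 &
      hr ar br ci ^+ 2 + hi ar br ci ^+ 2 = 1].
Proof.
rewrite /di /gr A1B3E; split.
- exact: (d_unimodular t2 ai2 bi2 ci'2 al12 al22 s122 b32 ci0 s120).
- exact: (e_unimodular t2 bi2 al12 al22 s122 s120).
- exact: (f_unimodular t2 ai2 ci'2 al12 al22 s142 ci0 s140).
- exact: (g_unimodular t2 cr2 ci'2 al12 al22 s142 b32 ci0 cr0 s140).
- exact: (h_unimodular ai2 bi2 cr2 ci'2 b32 ci0 b30).
Qed.

Lemma SF_hadamard :
  in_Icc_m1_1 (dr ar br ci) -> in_Icc_m1_1 (er ar br ci) ->
  in_Icc_m1_1 (fr ar br ci) -> in_Icc_m1_1 (gr ar br ci) ->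
  in_Icc_m1_1 (hr ar br ci) -> hadamard (SF ar br ci).
Proof.
have [d1 e1 f1 g1 h1] := SF_unimodular.
have norm1 (x y : R[i]) :
    x ^+ 2 + y ^+ 2 = 1 -> in_Icc_m1_1 x -> `|x + 'i%C * y| = 1.
  by move=> + [u u11 xE]; rewrite xE; exact: normc_unit_circle.
move=> /(norm1 _ _ d1) {}d1 /(norm1 _ _ e1) {}e1 /(norm1 _ _ f1) {}f1.
move=> /(norm1 _ _ g1) {}g1 /(norm1 _ _ h1) {}h1.
have [a1 _] := normc_Complex_cosqrt ar11.
have [b1 _] := normc_Complex_cosqrt br11.
have [_ c1] := normc_Complex_cosqrt ci11.
move: a1 b1 c1 d1 e1 f1 g1 h1; rewrite /SF.
(* Brings [a], [b], [c] into the shape [ar + t * ai] of the algebraic section, with [t] the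
   imaginary unit. *)
have CE (x y : R) : x +i* y = x%:C + 'i%C * y%:C := complexE _.
rewrite (CE ar) (CE br) (CE _ ci) /di /gr A1B3E.
move=> a1 b1 c1 d1 e1 f1 g1 h1.
apply: (T8F_hadamard a1 b1 c1 d1 e1 f1 g1 h1).
- exact: (T8F_condition1 t2 ai2 bi2 cr2 ci'2 al12 al22
    s122 s142 b32 ci0 cr0 s120 s140 b30).
- exact: (T8F_condition2 t2 ai2 bi2 cr2 ci'2 al12 al22
    s122 b32 ci0 s120).
- exact: (T8F_condition3 t2 ai2 bi2 cr2 ci'2 al12 al22
    s122 b32 ci0 s120 b30).
- exact: (T8F_condition4 t2 ai2 bi2 cr2 ci'2 al12 al22
    s142 b32 ci0 cr0 s140).
- exact: (T8F_condition5 t2 ai2 bi2 cr2 ci'2 al12 al22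
    s142 b32 ci0 cr0 s140 b30).
- exact: (T8F_condition6 t2 ai2 bi2 cr2 ci'2 al12 al22
    s122 s142 b32 ci0 cr0 s120 s140 b30).
Qed.

End SF_on_cube.

(** * Continuity and differentiability *)

(* Abstracts continuity at [p] (with [Q] trivial) and differentiability at [p]
   (with [Q] excluding [0]), so that the entries of [SF_map] are inspected only
   once. *)
Record regularity (R : realType) (T : Type) (p : T) (Q : R -> Prop)
    (P : (T -> R) -> Prop) : Prop := Regularity {
  regular_cst : forall c, P (fun=> c);
  regularD : forall f g, P f -> P g -> P (fun x => f x + g x);
  regularM : forall f g, P f -> P g -> P (fun x => f x * g x);
  regularV : forall f, P f -> f p != 0 -> P (fun x => (f x)^-1);
  regular_sqrt : forall f, P f -> Q (f p) -> P (fun x => Num.sqrt (f x))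
}.

Section Regularity.
Variables (R : realType) (T : Type) (p : T) (Q : R -> Prop).
Variable P : (T -> R) -> Prop.
Hypothesis regP : regularity p Q P.

Definition cregular (F : T -> R[i]) :=
  P (fun x => complex.Re (F x)) /\ P (fun x => complex.Im (F x)).

Let eqP f g : f =1 g -> P f -> P g.
Proof. by move=> /funext ->. Qed.

Lemma regularN f : P f -> P (fun x => - f x).
Proof.
by move=> Pf; apply: eqP (regularM regP (regular_cst regP (-1)) Pf) => x;
  rewrite mulN1r.
Qed.

Lemma regularB f g : P f -> P g -> P (fun x => f x - g x).
Proof. by move=> Pf Pg; apply/(regularD regP Pf)/regularN. Qed.

Lemma regularX f n : P f -> P (fun x => f x ^+ n).
Proof.
move=> Pf; elim: n => [|n IHn]; first exact: (regular_cst regP).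
by apply: eqP (regularM regP Pf IHn) => x; rewrite exprS.
Qed.

Lemma regular_norm f : P f -> Q (f p ^+ 2) -> P (fun x => `|f x|).
Proof.
move=> Pf Qf; apply: eqP (regular_sqrt regP (regularX 2 Pf) Qf) => x.
by rewrite sqrtr_sqr.
Qed.

Lemma regular_cosqrt f : P f -> Q (1 - f p ^+ 2) -> P (fun x => cosqrt (f x)).
Proof.
move=> Pf Qf; apply: (regular_sqrt regP) Qf.
by apply: regularB (regularX 2 Pf); exact: (regular_cst regP).
Qed.

Lemma cregular_Complex f g : P f -> P g -> cregular (fun x => f x +i* g x).
Proof. by []. Qed.

Lemma cregular_real f : P f -> cregular (fun x => (f x)%:C).
Proof. by move=> Pf; split=> //; exact: (regular_cst regP). Qed.

Lemma cregular_cst c : cregular (fun=> c).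
Proof. by split; exact: (regular_cst regP). Qed.

Lemma cregularD F G : cregular F -> cregular G -> cregular (fun x => F x + G x).
Proof.
move=> [F1 F2] [G1 G2]; split.
- by apply: eqP (regularD regP F1 G1) => x; case: (F x) (G x) => [? ?] [].
- by apply: eqP (regularD regP F2 G2) => x; case: (F x) (G x) => [? ?] [].
Qed.

Lemma cregularM F G : cregular F -> cregular G -> cregular (fun x => F x * G x).
Proof.
move=> [F1 F2] [G1 G2]; split.
- apply: eqP (regularB (regularM regP F1 G1) (regularM regP F2 G2)) => x.
  by case: (F x) (G x) => [u v] [w z].
- apply: eqP (regularD regP (regularM regP F1 G2) (regularM regP F2 G1)) => x.
  by case: (F x) (G x) => [u v] [w z].
Qed.

Lemma cregularN F : cregular F -> cregular (fun x => - F x).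
Proof.
by move=> [F1 F2]; split; [apply: eqP (regularN F1) => x|
  apply: eqP (regularN F2) => x]; case: (F x).
Qed.

(** The inverse is the conjugate divided by the squared modulus, and the latter is nonzero at
    [p]. *)
Lemma cregularV F : cregular F -> F p != 0 -> cregular (fun x => (F x)^-1).
Proof.
move=> [F1 F2] F0.
have N : P (fun x => (complex.Re (F x) ^+ 2 + complex.Im (F x) ^+ 2)^-1).
  apply: (regularV regP).
    exact: (regularD regP (regularX 2 F1) (regularX 2 F2)).
  apply: contra F0; case: (F p) => u v /=.
  by rewrite paddr_eq0 ?sqr_ge0// !sqrf_eq0 eq_complex.
split.
- by apply: eqP (regularM regP F1 N) => x; case: (F x).
- by apply: eqP (regularN (regularM regP F2 N)) => x; case: (F x).
Qed.

(** By [csqrtE] the components are the real roots of [f] and of [- f], hence a side condition for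
    each sign; this is what [Q2] records below. *)
Lemma cregular_csqrt f :
  P f -> Q (f p) -> Q (- f p) -> cregular (fun x => csqrt (f x)).
Proof.
move=> Pf Q1 Q2; split.
- by apply: eqP (regular_sqrt regP Pf Q1) => x; rewrite csqrtE.
- by apply: eqP (regular_sqrt regP (regularN Pf) Q2) => x; rewrite csqrtE.
Qed.

Lemma cregular_T8F a b c d e f g h : cregular a -> cregular b -> cregular c ->
  cregular d -> cregular e -> cregular f -> cregular g -> cregular h ->
  forall i j,
  cregular (fun x => T8F (a x) (b x) (c x) (d x) (e x) (f x) (g x) (h x) i j).
Proof.
move=> Pa Pb Pc Pd Pe Pf Pg Ph i j.
rewrite (_ : (fun x => _) = fun x => nth 0 (nth [::] (T8F_rows
  (a x) (b x) (c x) (d x) (e x) (f x) (g x) (h x)) i) j); last first.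
  by apply/funext => x; rewrite mxE.
case: i j => [[|[|[|[|[|[|[|[|i]]]]]]]] //= _]
  [[|[|[|[|[|[|[|[|j]]]]]]]] //= _];
  do ?[exact: cregular_cst | apply: cregularN | apply: cregularM
      | assumption].
Qed.

Variables (ar br ci : T -> R).
Hypotheses (Par : P ar) (Pbr : P br) (Pci : P ci).
Hypothesis defd : SF_defined (ar p) (br p) (ci p).
Let Q2 (f : T -> R) := Q (f p) /\ Q (- f p).
Hypotheses (Qai : Q (1 - ar p ^+ 2)) (Qbi : Q (1 - br p ^+ 2))
  (Qcr : Q (1 - ci p ^+ 2)) (Qci : Q (ci p ^+ 2)).
Hypotheses (QA1 : Q2 (fun x => A1 (ar x) (br x) (ci x)))
  (QA2 : Q2 (fun x => A2 (ar x) (br x) (ci x)))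
  (QB12 : Q2 (fun x => B1 (ar x) (br x) (ci x) * B2 (ar x) (br x) (ci x)))
  (QB14 : Q2 (fun x => B1 (ar x) (br x) (ci x) * B4 (ar x) (br x) (ci x)))
  (QA1B3 : Q2 (fun x => A1 (ar x) (br x) (ci x) * B3 (ar x) (br x) (ci x)))
  (QB3 : Q2 (fun x => B3 (ar x) (br x) (ci x))).

Let Pai := regular_cosqrt Par Qai.
Let Pbi := regular_cosqrt Pbr Qbi.
Let Pcr := regular_cosqrt Pci Qcr.

Ltac regular := repeat first [assumption | apply: regularB | apply: regularN
  | apply: (regularD regP) | apply: (regularM regP) | apply: regularX].

Lemma regular_A1 : P (fun x => A1 (ar x) (br x) (ci x)).
Proof. rewrite /A1; regular. Qed.
Lemma regular_A2 : P (fun x => A2 (ar x) (br x) (ci x)).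
Proof. rewrite /A2; regular. Qed.
Lemma regular_B1 : P (fun x => B1 (ar x) (br x) (ci x)).
Proof. rewrite /B1; regular. Qed.
Lemma regular_B2 : P (fun x => B2 (ar x) (br x) (ci x)).
Proof. rewrite /B2; regular. Qed.
Lemma regular_B3 : P (fun x => B3 (ar x) (br x) (ci x)).
Proof. rewrite /B3; regular. Qed.
Lemma regular_B4 : P (fun x => B4 (ar x) (br x) (ci x)).
Proof. rewrite /B4; regular. Qed.

Let PA1 := regular_A1. Let PA2 := regular_A2. Let PB1 := regular_B1.
Let PB2 := regular_B2. Let PB3 := regular_B3. Let PB4 := regular_B4.

Let CA1 : cregular (fun x => csqrt (A1 (ar x) (br x) (ci x))).
Proof. by case: QA1; exact: cregular_csqrt. Qed.
Let CA2 : cregular (fun x => csqrt (A2 (ar x) (br x) (ci x))).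
Proof. by case: QA2; exact: cregular_csqrt. Qed.
Let CB12 : cregular (fun x => sqrtB12 (ar x) (br x) (ci x)).
Proof. by case: QB12; apply: cregular_csqrt; exact: (regularM regP). Qed.
Let CB14 : cregular (fun x => sqrtB14 (ar x) (br x) (ci x)).
Proof. by case: QB14; apply: cregular_csqrt; exact: (regularM regP). Qed.
Let CA1B3 : cregular (fun x => sqrtA1B3 (ar x) (br x) (ci x)).
Proof. by case: QA1B3; apply: cregular_csqrt; exact: (regularM regP). Qed.
Let CB3 : cregular (fun x => csqrt (B3 (ar x) (br x) (ci x))).
Proof. by case: QB3; exact: cregular_csqrt. Qed.

Let Car := cregular_real Par. Let Cbr := cregular_real Pbr.
Let Cci := cregular_real Pci. Let Cai := cregular_real Pai.
Let Cbi := cregular_real Pbi. Let Ccr := cregular_real Pcr.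
Let Cci' := cregular_real (regular_norm Pci Qci).
Let Ci := cregular_cst 'i%C.

Let nz : [&& (ci p)%:C != 0, sqrtB12 (ar p) (br p) (ci p) != 0,
  (cosqrt (ci p))%:C != 0, sqrtB14 (ar p) (br p) (ci p) != 0,
  csqrt (B3 (ar p) (br p) (ci p)) != 0 & `|ci p|%:C != 0 :> R[i]].
Proof.
have C0 (x : R) : (x%:C == 0 :> R[i]) = (x == 0).
  by rewrite eq_complex /= eqxx andbT.
case: defd; rewrite !mulf_eq0 !negb_or !C0 normr_eq0.
by move=> /andP[-> ->] _ _ /andP[-> ->] /andP[-> _].
Qed.

Ltac cregular :=
  rewrite /dr /di /er /ei /fr /fi /gr /gi /hr /hi;
  repeat first [assumption | apply: cregularD | apply: cregularN
    | apply: cregularM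
    | apply: cregularV; [|by move: nz => /and5P[? ? ? ? /andP[? ?]];
        rewrite ?mulf_neq0]].

Lemma cregular_d :
  cregular (fun x => dr (ar x) (br x) (ci x) + 'i%C * di (ar x) (br x) (ci x)).
Proof. cregular. Qed.
Lemma cregular_e :
  cregular (fun x => er (ar x) (br x) (ci x) + 'i%C * ei (ar x) (br x) (ci x)).
Proof. cregular. Qed.
Lemma cregular_f :
  cregular (fun x => fr (ar x) (br x) (ci x) + 'i%C * fi (ar x) (br x) (ci x)).
Proof. cregular. Qed.
Lemma cregular_g :
  cregular (fun x => gr (ar x) (br x) (ci x) + 'i%C * gi (ar x) (br x) (ci x)).
Proof. cregular. Qed.
Lemma cregular_h :
  cregular (fun x => hr (ar x) (br x) (ci x) + 'i%C * hi (ar x) (br x) (ci x)).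
Proof. cregular. Qed.

Lemma cregular_SF i j : cregular (fun x => SF (ar x) (br x) (ci x) i j).
Proof.
apply: cregular_T8F.
- exact: cregular_Complex.
- exact: cregular_Complex.
- exact: cregular_Complex.
- exact: cregular_d.
- exact: cregular_e.
- exact: cregular_f.
- exact: cregular_g.
- exact: cregular_h.
Qed.

End Regularity.

Lemma continuous_regularity (R : realType) (T : topologicalType) (p : T) :
  regularity p (fun=> True) (fun f : T -> R => {for p, continuous f}).
Proof.
split=> [c|f g|f g|f ? ?|f cf _].
- exact: cst_continuous.
- exact: continuousD.
- exact: continuousM.
- exact: continuousV.
- by apply: (@continuous_comp _ _ _ f) => //; exact: sqrt_continuous.
Qed.

(** To the left of 0 the real root is locally the constant 0, so only the origin is excluded. *)
Lemma differentiable_sqrt (R : realType) (x : R) :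
  x != 0 -> differentiable (Num.sqrt : R -> R) x.
Proof.
rewrite neq_lt => /orP[x0|x0]; apply/derivable1_diffP; last first.
  by have [] := is_derive1_sqrt x0.
apply: (@near_eq_derivable _ _ _ (cst 0)); last exact: derivable_cst.
near=> y; rewrite ler0_sqrtr//; apply: ltW; near: y; exact: lt_nbhsl.
Unshelve. all: by end_near. Qed.

Lemma differentiable_regularity (R : realType) (V : normedModType R) (p : V) :
  regularity p (fun x => x != 0) (fun f : V -> R => differentiable f p).
Proof.
split=> [c|f g|f g|f|f df f0].
- exact: differentiable_cst.
- exact: differentiableD.
- exact: differentiableM.
- exact: differentiableV.
- exact/(differentiable_comp df)/differentiable_sqrt.
Qed.

(** * Matrix-valued maps treated through their entries *)

Lemma continuous_mx (K : realType) (T : topologicalType) m n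
    (f : T -> 'M[K]_(m, n)) (p : T) :
  (forall i j, {for p, continuous (fun x => f x i j)}) ->
  {for p, continuous f}.
Proof.
move=> fp A [P nP sPA]; have : \forall x \near p, forall i j, P i j (f x i j).
  apply: filter_forall => i; apply: filter_forall => j.
  exact: fp (nP i j).
by apply: filterS => x Px; exact: sPA.
Qed.

Lemma differentiable_rV (K : realType) (V : normedModType K) n
    (f : V -> 'rV[K]_n) (p : V) :
  (forall j, differentiable (fun x => f x 0 j) p) -> differentiable f p.
Proof.
move=> fp.
have -> : f = \sum_(j < n) (fun x => f x 0 j *: 'e_j) :> (V -> 'rV[K]_n).
  by apply: funext => x; rewrite fct_sumE; exact: row_sum_delta.
by apply: differentiable_sum => j; exact: differentiableZl.
Qed.

Lemma realifyE (R : realType) n (M : 'M[R[i]]_n) (i j : 'I_n) :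
  realify M 0 (lshift (n * n) (mxvec_index i j)) = complex.Re (M i j) /\
  realify M 0 (rshift (n * n) (mxvec_index i j)) = complex.Im (M i j).
Proof. by rewrite row_mxEl row_mxEr !mxvecE !mxE. Qed.

Lemma realifyP (R : realType) n (T : Type) (Q : (T -> R) -> Prop)
    (F : T -> 'M[R[i]]_n) :
  (forall i j, Q (fun x => complex.Re (F x i j)) /\
               Q (fun x => complex.Im (F x i j))) ->
  forall k, Q (fun x => realify (F x) 0 k).
Proof.
move=> QF k; case: (split_ordP k) => l ->; case/mxvec_indexP: l => i j.
- have -> : (fun x => realify (F x) 0 (lshift _ (mxvec_index i j))) =
      (fun x => complex.Re (F x i j)).
    by apply/funext => x; case: (realifyE (F x) i j).
  by case: (QF i j).
- have -> : (fun x => realify (F x) 0 (rshift _ (mxvec_index i j))) =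
      (fun x => complex.Im (F x i j)).
    by apply/funext => x; case: (realifyE (F x) i j).
  by case: (QF i j).
Qed.

(** The denominators do not vanish on the domain, so the map is continuous at each of its points
    already in the ambient space, hence also in the subspace. *)
Lemma SF_map_continuous (R : realType) :
  {within @SF_dom R, continuous (@realify R 8 \o @SF_map R)}.
Proof.
apply: continuous_in_subspaceT => p; rewrite inE => -[_ defd _].
apply: continuous_mx => i k; rewrite ord1.
apply: (realifyP (Q := fun f => {for p, continuous f})) => {i k} i j.
apply: (cregular_SF (continuous_regularity R p)) => //;
  exact: coord_continuous.
Qed.

(** * An interior point *)

Section Interior.
Variables (R : realType) (ar br ci : R).
Hypotheses (ar11 : -1 < ar < 1) (br11 : -1 < br < 1) (ci11 : -1 < ci < 1).
Hypotheses (ci0 : ci != 0) (A1_lt0 : A1 ar br ci < 0) (A2_gt0 : 0 < A2 ar br ci)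
  (B12_gt0 : 0 < B1 ar br ci * B2 ar br ci)
  (B14_lt0 : B1 ar br ci * B4 ar br ci < 0) (B3_gt0 : 0 < B3 ar br ci).

Let cosqrt_gt0 (x : R) : -1 < x < 1 -> 0 < cosqrt x.
Proof. by move=> x11; rewrite sqrtr_gt0; nra. Qed.

Let neq0C (x : R) : x != 0 -> x%:C != 0 :> R[i].
Proof. by rewrite eq_complex /= eqxx andbT. Qed.

Let csqrt_neq0 (x : R) : x != 0 -> csqrt x != 0.
Proof. by move=> x0; rewrite sqrtc_eq0 neq0C. Qed.

Lemma SF_defined_inside : SF_defined ar br ci.
Proof.
have B3_neq0 := csqrt_neq0 (lt0r_neq0 B3_gt0).
have B12_neq0 := csqrt_neq0 (lt0r_neq0 B12_gt0).
have B14_neq0 := csqrt_neq0 (ltr0_neq0 B14_lt0).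
have cr_neq0 := neq0C (lt0r_neq0 (cosqrt_gt0 ci11)).
by split=> //; rewrite mulf_neq0// neq0C.
Qed.

(** [s + t = 1] with both terms nonnegative gives [s <= 1], and [x] is plus or minus the real root
    of [s]. *)
Lemma in_Icc_circle (x y : R[i]) (s t : R) :
  x ^+ 2 = s%:C -> y ^+ 2 = t%:C -> 0 <= s -> 0 <= t ->
  x ^+ 2 + y ^+ 2 = 1 -> in_Icc_m1_1 x.
Proof.
move=> xs yt s0 t0; rewrite xs yt -rmorphD => -[] st1.
have u2 : Num.sqrt s ^+ 2 = s by rewrite sqr_sqrtr.
have u0 : 0 <= Num.sqrt s by exact: sqrtr_ge0.
have xu : x ^+ 2 = (Num.sqrt s)%:C ^+ 2 by rewrite xs -rmorphXn /= u2.
move/eqP: xu; rewrite eqf_sqr => /orP[] /eqP ->.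
- by exists (Num.sqrt s) => //; nra.
- by exists (- Num.sqrt s); [nra | rewrite rmorphN].
Qed.

Let sqrE := (exprMn, exprVn, sqrrN, sqr_i, csqrt_sqr, mulN1r).
Let toC := (rmorphXn, rmorphN, rmorphM, fmorphV).

Ltac sign := solve [ done
  | rewrite oppr_ge0; sign | rewrite invr_ge0; sign | rewrite invr_le0; sign
  | apply: mulr_ge0; sign | apply: mulr_le0; sign
  | apply: mulr_ge0_le0; sign | apply: mulr_le0_ge0; sign ].

(** The assumed signs make the square of every coordinate, real and imaginary part alike, a
    nonnegative real number; unimodularity then bounds the real parts. *)
Lemma SF_in_Icc :
  [/\ in_Icc_m1_1 (dr ar br ci), in_Icc_m1_1 (er ar br ci),
      in_Icc_m1_1 (fr ar br ci), in_Icc_m1_1 (gr ar br ci) &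
      in_Icc_m1_1 (hr ar br ci)].
Proof.
have le11 (x : R) : -1 < x < 1 -> -1 <= x <= 1.
  by move=> /andP[/ltW-> /ltW->].
have [d1 e1 f1 g1 h1] :=
  SF_unimodular (le11 _ ar11) (le11 _ br11) (le11 _ ci11) SF_defined_inside.
have A1_le0 := ltW A1_lt0; have A2_ge0 := ltW A2_gt0; have B3_ge0 := ltW B3_gt0.
pose B12 := B1 ar br ci * B2 ar br ci; pose B14 := B1 ar br ci * B4 ar br ci.
pose A13 := A1 ar br ci * B3 ar br ci.
have B12_ge0 : 0 <= B12 := ltW B12_gt0; have B14_le0 : B14 <= 0 := ltW B14_lt0.
have A13_le0 : A13 <= 0 by rewrite mulr_le0_ge0.
have S12 : sqrtB12 ar br ci ^+ 2 = B12%:C by exact: csqrt_sqr.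
have S14 : sqrtB14 ar br ci ^+ 2 = B14%:C by exact: csqrt_sqr.
have S13 : sqrtA1B3 ar br ci ^+ 2 = A13%:C by exact: csqrt_sqr.
have sq0 (x : R) : 0 <= x ^+ 2 by exact: sqr_ge0.
(* The products under the roots become atoms of known sign for the tactic [sign]. *)
clearbody B12 B14 A13; split.
- apply: (@in_Icc_circle _ _
    (cosqrt br ^+ 2 * A2 ar br ci / (ci ^+ 2 * B12))
    (- (cosqrt ar ^+ 2 * A13 / (`|ci| ^+ 2 * B12)))
    _ _ _ _ d1); [| |sign|sign].
  + by rewrite /dr !(S12, S13, S14, sqrE) !toC.
  + by rewrite /di !(S12, S13, S14, sqrE) !toC.
- apply: (@in_Icc_circle _ _
    (A2 ar br ci / B12)
    (- (ar ^+ 2 * cosqrt br ^+ 2 * A1 ar br ci / B12))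
    _ _ _ _ e1); [| |sign|sign].
  + by rewrite /er !(S12, S13, S14, sqrE) !toC.
  + by rewrite /ei !(S12, S13, S14, sqrE) !toC.
- apply: (@in_Icc_circle _ _
    (cosqrt ar ^+ 2 * br ^+ 2 * `|ci| ^+ 2 * A1 ar br ci / (ci ^+ 2 * B14))
    (- (`|ci| ^+ 2 * A2 ar br ci / (ci ^+ 2 * B14)))
    _ _ _ _ f1); [| |sign|sign].
  + by rewrite /fr !(S12, S13, S14, sqrE) !toC.
  + by rewrite /fi !(S12, S13, S14, sqrE) !toC.
- apply: (@in_Icc_circle _ _
    (ar ^+ 2 * A13 / (cosqrt ci ^+ 2 * B14))
    (- (br ^+ 2 * `|ci| ^+ 2 * A2 ar br ci / (cosqrt ci ^+ 2 * ci ^+ 2 * B14)))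
    _ _ _ _ g1); [| |sign|sign].
  + by rewrite /gr !(S12, S13, S14, sqrE) !toC.
  + by rewrite /gi !(S12, S13, S14, sqrE) !toC.
- apply: (@in_Icc_circle _ _
    (cosqrt ar ^+ 2 * br ^+ 2 * cosqrt ci ^+ 2 * `|ci| ^+ 2
     / (B3 ar br ci * ci ^+ 2))
    (ar ^+ 2 * cosqrt br ^+ 2 * `|ci| ^+ 2 / B3 ar br ci)
    _ _ _ _ h1); [| |sign|sign].
  + by rewrite /hr !(S12, S13, S14, sqrE) !toC.
  + by rewrite /hi !(S12, S13, S14, sqrE) !toC.
Qed.

End Interior.

(** The five values are [-3/4], [1/64], [13/64], [-1/64] and [1/16]. *)
Lemma half_inside (R : realType) (h := 2^-1 : R) :
  [/\ A1 h 0 h < 0, 0 < A2 h 0 h, 0 < B1 h 0 h * B2 h 0 h,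
      B1 h 0 h * B4 h 0 h < 0 & 0 < B3 h 0 h].
Proof.
have h2 : cosqrt h ^+ 2 = 1 - h ^+ 2 by apply: cosqrt_sqr; rewrite /h; lra.
have c0 : cosqrt (0 : R) = 1 by rewrite /cosqrt expr0n /= subr0 sqrtr1.
rewrite /A1 /A2 /B1 /B2 /B3 /B4 /= c0 !h2 /h; split; lra.
Qed.

(** * Rank of the Jacobian *)

Section Derivative.
Variables (R : realType) (V : normedModType R) (p v : V).
Implicit Types F G : V -> R[i].

(** Taken componentwise, because the Jacobian is that of a map between real spaces. *)
Definition cderive F : R[i] :=
  'D_v (fun x => complex.Re (F x)) p +i* 'D_v (fun x => complex.Im (F x)) p.

Lemma cderiveM F G : cregular (fun f : V -> R => differentiable f p) F ->
  cregular (fun f : V -> R => differentiable f p) G ->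
  cderive (fun x => F x * G x) = cderive F * G p + F p * cderive G.
Proof.
move=> [F1 F2] [G1 G2]; rewrite /cderive.
have ReM (z w : R[i]) : complex.Re (z * w) =
  complex.Re z * complex.Re w - complex.Im z * complex.Im w.
  by case: z w => ? ? [].
have ImM (z w : R[i]) : complex.Im (z * w) =
  complex.Re z * complex.Im w + complex.Im z * complex.Re w.
  by case: z w => ? ? [].
have -> : (fun x => complex.Re (F x * G x)) =
    (fun x => complex.Re (F x)) * (fun x => complex.Re (G x))
    - (fun x => complex.Im (F x)) * (fun x => complex.Im (G x)).
  by apply: funext => x; exact: ReM.
have -> : (fun x => complex.Im (F x * G x)) =
    (fun x => complex.Re (F x)) * (fun x => complex.Im (G x))
    + (fun x => complex.Im (F x)) * (fun x => complex.Re (G x)).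
  by apply: funext => x; exact: ImM.
have dD (f : V -> R) : differentiable f p -> derivable f p v.
  exact: diff_derivable.
rewrite deriveB; do ?[exact/dD/differentiableM].
rewrite deriveD; do ?[exact/dD/differentiableM].
rewrite !deriveM; do ?[exact: dD].
have calc (a b c d x y z w : R) :
    (a *: z + c *: x - (b *: w + d *: y))
      +i* (a *: w + d *: x + (b *: z + c *: y))
    = (x +i* y) * (c +i* d) + (a +i* b) * (z +i* w).
  by rewrite /GRing.scale; congr Complex => /=; ring.
by move: (F p) (G p) => [a b] [c d]; exact: calc.
Qed.

(** In [e (ab)' + b (ae)' - a (be)'] the terms with [b'] and [e'] cancel, leaving [2 a' b e]. *)
Lemma cderive_eq0 a b e :
  cregular (fun f : V -> R => differentiable f p) a ->
  cregular (fun f : V -> R => differentiable f p) b ->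
  cregular (fun f : V -> R => differentiable f p) e ->
  b p != 0 -> e p != 0 ->
  cderive (fun x => a x * b x) = 0 -> cderive (fun x => a x * e x) = 0 ->
  cderive (fun x => b x * e x) = 0 -> cderive a = 0.
Proof.
move=> Pa Pb Pe b0 e0; rewrite !cderiveM// => ab ae be.
apply/eqP; have : 2 * (cderive a * (b p * e p)) == 0.
  rewrite -[X in _ == X](_ : e p * (cderive a * b p + a p * cderive b)
    + b p * (cderive a * e p + a p * cderive e)
    - a p * (cderive b * e p + b p * cderive e) = 0).
    by apply/eqP; ring.
  by rewrite ab ae be !mulr0 subr0 addr0.
by rewrite !mulf_eq0 pnatr_eq0 (negbTE b0) (negbTE e0) !orbF.
Qed.
End Derivative.

(** * Interior membership, differentiability and full rank at [(1/2, 0, 1/2)] *)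

Section BasePoint.
Variable R : realType.
Let p : 'rV[R]_3 := \row_(j < 3) [:: 2^-1; 0; 2^-1]`_j.
Let p0 : p 0 0 = 2^-1. Proof. by rewrite mxE. Qed.
Let p1 : p 0 1 = 0. Proof. by rewrite mxE. Qed.
Let p2 : p 0 2%:R = 2^-1. Proof. by rewrite mxE. Qed.

Let p_inside : let ar := p 0 0 in let br := p 0 1 in let ci := p 0 2%:R in
  [/\ A1 ar br ci < 0, 0 < A2 ar br ci, 0 < B1 ar br ci * B2 ar br ci,
      B1 ar br ci * B4 ar br ci < 0 & 0 < B3 ar br ci].
Proof. by rewrite /= p0 p1 p2; exact: half_inside. Qed.

Let reg := continuous_regularity R p.
Let coord (j : 'I_3) : {for p, continuous (fun q : 'rV[R]_3 => q 0 j)}.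
Proof. exact: coord_continuous. Qed.

Let near_gt (f : 'rV[R]_3 -> R) (c : R) :
  {for p, continuous f} -> c < f p -> \forall q \near p, c < f q.
Proof. by move=> cf; exact: (cvgr_gt (f p) cf). Qed.

Let near_lt (f : 'rV[R]_3 -> R) (c : R) :
  {for p, continuous f} -> f p < c -> \forall q \near p, f q < c.
Proof. by move=> cf; exact: (cvgr_lt (f p) cf). Qed.

Lemma SF_dom_interior : (@SF_dom R)^° p.
Proof.
have [a1 a2 b12 b14 b3] := p_inside.
have P0 := @coord 0; have P1 := @coord 1; have P2 := @coord 2%:R.
(* [I] discharges the side conditions of the square roots, which are [True] in the case of
   continuity. *)
have cA1 := regular_A1 reg (fun q : 'rV[R]_3 => q 0 0) P1 P2 I.
have cA2 := regular_A2 reg P0 P1 P2 I.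
have cB1 := regular_B1 reg (fun q : 'rV[R]_3 => q 0 2%:R) P0 P1.
have cB2 := regular_B2 reg P0 P1 P2 I; have cB3 := regular_B3 reg P0 P1 P2 I.
have cB4 := regular_B4 reg P0 P1 P2 I.
(* Every condition imposed on [q] is a strict inequality on a continuous function that holds at [p],
   so it persists nearby; [ci0] comes from positivity of the third coordinate. *)
near=> q.
have q0 : -1 < q 0 0 < 1.
  apply/andP; split; near: q; [apply: (near_gt P0)|apply: (near_lt P0)];
    rewrite p0; lra.
have q1 : -1 < q 0 1 < 1.
  apply/andP; split; near: q; [apply: (near_gt P1)|apply: (near_lt P1)];
    rewrite p1; lra.
have q2 : -1 < q 0 2%:R < 1.
  apply/andP; split; near: q; [apply: (near_gt P2)|apply: (near_lt P2)];
    rewrite p2; lra.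
have ci0 : q 0 2%:R != 0.
  by apply: lt0r_neq0; near: q; apply: (near_gt P2); rewrite p2; lra.
have qA1 : A1 (q 0 0) (q 0 1) (q 0 2%:R) < 0 by near: q; exact: (near_lt cA1).
have qA2 : 0 < A2 (q 0 0) (q 0 1) (q 0 2%:R) by near: q; exact: (near_gt cA2).
have qB12 : 0 < B1 (q 0 0) (q 0 1) (q 0 2%:R) * B2 (q 0 0) (q 0 1) (q 0 2%:R).
  by near: q; exact: (near_gt (regularM reg cB1 cB2)).
have qB14 : B1 (q 0 0) (q 0 1) (q 0 2%:R) * B4 (q 0 0) (q 0 1) (q 0 2%:R) < 0.
  by near: q; exact: (near_lt (regularM reg cB1 cB4)).
have qB3 : 0 < B3 (q 0 0) (q 0 1) (q 0 2%:R) by near: q; exact: (near_gt cB3).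
split.
- by move: q0 q1 q2 => /andP[/ltW-> /ltW->] /andP[/ltW-> /ltW->]
    /andP[/ltW-> /ltW->].
- exact: SF_defined_inside.
- exact: SF_in_Icc.
Unshelve. all: by end_near. Qed.

Let p_dom : SF_dom p. Proof. exact: (interior_subset SF_dom_interior). Qed.

Notation diff := (fun f : 'rV[R]_3 -> R => differentiable f p).

Let dreg := differentiable_regularity p.

Let dcoord (j : 'I_3) : differentiable (fun q : 'rV[R]_3 => q 0 j) p.
Proof. exact: differentiable_coord. Qed.

Let neq0 (x : R) : x < 0 \/ 0 < x -> x != 0 /\ - x != 0.
Proof. by rewrite oppr_eq0 neq_lt => -[] ->; rewrite ?orbT. Qed.

Let D0 : 1 - p 0 0 ^+ 2 != 0. Proof. by rewrite p0; apply: lt0r_neq0; lra. Qed.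
Let D1 : 1 - p 0 1 ^+ 2 != 0. Proof. by rewrite p1; apply: lt0r_neq0; lra. Qed.
Let D2 : 1 - p 0 2%:R ^+ 2 != 0.
Proof. by rewrite p2; apply: lt0r_neq0; lra. Qed.
Let E2 : p 0 2%:R ^+ 2 != 0. Proof. by rewrite p2; apply: lt0r_neq0; lra. Qed.

Let defd : SF_defined (p 0 0) (p 0 1) (p 0 2%:R). Proof. by case: p_dom. Qed.

Local Notation at_p X := (X R (p 0 0) (p 0 1) (p 0 2%:R)).

Let nA1 : at_p (@A1) != 0 /\ - at_p (@A1) != 0.
Proof. by apply: neq0; case: p_inside; left. Qed.
Let nA2 : at_p (@A2) != 0 /\ - at_p (@A2) != 0.
Proof. by apply: neq0; case: p_inside; right. Qed.
Let nB12 : at_p (@B1) * at_p (@B2) != 0 /\ - (at_p (@B1) * at_p (@B2)) != 0.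
Proof. by apply: neq0; case: p_inside; right. Qed.
Let nB14 : at_p (@B1) * at_p (@B4) != 0 /\ - (at_p (@B1) * at_p (@B4)) != 0.
Proof. by apply: neq0; case: p_inside; left. Qed.
Let nB3 : at_p (@B3) != 0 /\ - at_p (@B3) != 0.
Proof. by apply: neq0; case: p_inside; right. Qed.
Let nA1B3 : at_p (@A1) * at_p (@B3) != 0 /\ - (at_p (@A1) * at_p (@B3)) != 0.
Proof.
by apply: neq0; left; case: p_inside => a1 _ _ _ b3; rewrite pmulr_llt0.
Qed.

Let Da : cregular diff (fun q => q 0 0 +i* cosqrt (q 0 0)).
Proof. by apply: cregular_Complex => //; exact: (regular_cosqrt dreg). Qed.
Let Db : cregular diff (fun q => q 0 1 +i* cosqrt (q 0 1)).
Proof. by apply: cregular_Complex => //; exact: (regular_cosqrt dreg). Qed.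
Let Dc : cregular diff (fun q => cosqrt (q 0 2%:R) +i* q 0 2%:R).
Proof. by apply: cregular_Complex => //; exact: (regular_cosqrt dreg). Qed.
Let Dd := cregular_d dreg (dcoord 0) (dcoord 1) (dcoord 2%:R) defd
  D0 D1 D2 E2 nA2 nB12 nA1B3.
Let De := cregular_e dreg (dcoord 0) (dcoord 1) (dcoord 2%:R) defd
  D0 D1 D2 nA1 nA2 nB12.
Let Dh := cregular_h dreg (dcoord 0) (dcoord 1) (dcoord 2%:R) defd
  D0 D1 D2 E2 nB3.
Let DSF := cregular_SF dreg (dcoord 0) (dcoord 1) (dcoord 2%:R) defd
  D0 D1 D2 E2 nA1 nA2 nB12 nB14 nA1B3 nB3.

Lemma SF_map_differentiable : differentiable (@realify R 8 \o @SF_map R) p.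
Proof.
apply: differentiable_rV => k.
by apply: (realifyP (Q := fun f => differentiable f p)) => i j; exact: DSF.
Qed.

(** In the row convention [v *m 'J] is the derivative along [v]; its coordinates are the real and
    imaginary parts of the derivatives of the entries. *)
Let cderive0 (v : 'rV[R]_3) :
  v *m 'J (@realify R 8 \o @SF_map R) p = 0 ->
  forall i j, cderive p v (fun q => SF_map q i j) = 0.
Proof.
move=> vJ i j.
rewrite -deriveEjacobian in vJ; last exact: SF_map_differentiable.
rewrite derive_mx in vJ; last exact/diff_derivable/SF_map_differentiable.
have key k : 'D_v (fun q => realify (SF_map q) 0 k) p = 0.
  by have := congr1 (fun M : 'rV[R]_(8 * 8 + 8 * 8) => M 0 k) vJ; rewrite !mxE.
rewrite /cderive.
have -> : (fun q : 'rV[R]_3 => complex.Re (SF_map q i j)) =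
    (fun q => realify (SF_map q) 0 (lshift _ (mxvec_index i j))).
  by apply: funext => q; case: (realifyE (SF_map q) i j).
have -> : (fun q : 'rV[R]_3 => complex.Im (SF_map q i j)) =
    (fun q => realify (SF_map q) 0 (rshift _ (mxvec_index i j))).
  by apply: funext => q; case: (realifyE (SF_map q) i j).
by rewrite !key.
Qed.

(** Entries of a Hadamard matrix have modulus 1, so the parameters are seen to be nonzero at [p]
    without being evaluated. *)
Let entry i j (x y : R[i]) : SF_map p i j = x * y -> x != 0 /\ y != 0.
Proof.
have [M1 _] : hadamard (SF_map p).
  by case: p_dom => -[? ? ?] ? [*]; exact: SF_hadamard.
have : SF_map p i j != 0 by rewrite -normr_eq0 M1 oner_eq0.
by move=> /[swap] ->; rewrite mulf_eq0 negb_or => /andP[].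
Qed.

Lemma SF_map_rank : \rank ('J (@realify R 8 \o @SF_map R) p) = 3%N.
Proof.
(* The matrix has three rows, so rank 3 means that its left kernel is trivial. *)
apply/eqP; rewrite -/(row_free _); apply: inj_row_free => v /cderive0 v0.
have v0E i j (F : 'rV[R]_3 -> R[i]) :
    (forall q, SF_map q i j = F q) -> cderive p v F = 0.
  by move=> /funext <-.
have nE i j (F G : 'rV[R]_3 -> R[i]) :
    (forall q, SF_map q i j = F q * G q) -> F p != 0 /\ G p != 0.
  by move=> FG; exact: (@entry i j).
pose i4 : 'I_8 := Ordinal (isT : 4 < 8)%N.
pose i5 : 'I_8 := Ordinal (isT : 5 < 8)%N.
pose a (q : 'rV[R]_3) : R[i] := q 0 0 +i* cosqrt (q 0 0).
pose b (q : 'rV[R]_3) : R[i] := q 0 1 +i* cosqrt (q 0 1).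
pose c (q : 'rV[R]_3) : R[i] := cosqrt (q 0 2%:R) +i* q 0 2%:R.
pose d (q : 'rV[R]_3) :=
  dr (q 0 0) (q 0 1) (q 0 2%:R) + 'i%C * di (q 0 0) (q 0 1) (q 0 2%:R).
pose e (q : 'rV[R]_3) :=
  er (q 0 0) (q 0 1) (q 0 2%:R) + 'i%C * ei (q 0 0) (q 0 1) (q 0 2%:R).
pose h (q : 'rV[R]_3) :=
  hr (q 0 0) (q 0 1) (q 0 2%:R) + 'i%C * hi (q 0 0) (q 0 1) (q 0 2%:R).
(* Indices count from 0. The positions are chosen so that the pairwise products of [a], [b], [e] and
   of [c], [d], [h] appear without a minus sign. *)
have abE q : SF_map q 0 1 = a q * b q by rewrite mxE.
have aeE q : SF_map q i5 0 = a q * e q by rewrite mxE.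
have beE q : SF_map q i4 0 = b q * e q by rewrite mxE.
have cdE q : SF_map q 0 i4 = c q * d q by rewrite mxE.
have dhE q : SF_map q 0 i5 = d q * h q by rewrite mxE.
have chE q : SF_map q i5 i4 = c q * h q by rewrite mxE.
have baE q : SF_map q 0 1 = b q * a q by rewrite abE mulrC.
have [a0 b0] := nE _ _ _ _ abE; have [_ e0] := nE _ _ _ _ beE.
have [d0 h0] := nE _ _ _ _ dhE.
have a'0 := cderive_eq0 Da Db De b0 e0
  (v0E _ _ _ abE) (v0E _ _ _ aeE) (v0E _ _ _ beE).
have b'0 := cderive_eq0 Db Da De a0 e0
  (v0E _ _ _ baE) (v0E _ _ _ beE) (v0E _ _ _ aeE).
have c'0 := cderive_eq0 Dc Dd Dh d0 h0
  (v0E _ _ _ cdE) (v0E _ _ _ chE) (v0E _ _ _ dhE).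
have vE j : 'D_v (fun q : 'rV[R]_3 => q 0 j) p = v 0 j.
  by rewrite -[in RHS](derive_id p v) derive_mx ?mxE//; exact: derivable_id.
(* The real parts of [a] and [b] and the imaginary part of [c] are the three coordinates, whose
   derivatives along [v] are the entries of [v]. *)
case: a'0 b'0 c'0 => + _ [+ _] [_ +]; rewrite !vE => v00 v01 v02.
apply/rowP => j; rewrite mxE.
by case: j => [[|[|[|j]]] //= jlt];
  [rewrite -[RHS]v00|rewrite -[RHS]v01|rewrite -[RHS]v02];
  congr (v _ _); apply/val_inj.
Qed.

End BasePoint.

Theorem theorem4p10 (R : realType) :
  parameter_family (@SF_dom R) (@SF_map R) (@T8F3 R).
Proof.
split=> [//|p [] [? ? ?] ? []||]; first exact: SF_hadamard.
- exact: SF_map_continuous.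
- exists (\row_(j < 3) [:: 2^-1; 0; 2^-1]`_j); split.
  + exact: SF_dom_interior.
  + exact: SF_map_differentiable.
  + exact: SF_map_rank.
Qed.
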